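(* Let $T$ be a homogeneous tree of homogeneity degree $q$, with reference edge $e_0$. For the edge-horospherical Radon transform $\psi=\mathcal R_Ef$ of finitely supported functions $f$ on $E$ that are radial around $e_0$, there are uncountably many choices of complex coefficients $l_n$ such that the following inversion formula holds, where $\psi_n=\mathcal R_Ef(\omega,n)$ (which does not depend on $\omega$): $$f(e_0)=\sum_{n\in\mathbb Z}l_n\,\psi_n .$$ Two distinct explicit choices for the coefficients $l_n$ are $$l_n=\begin{cases}0& \text{if } n \text{ is odd or } n<0,\\ 1& \text{if } n=0,\\ \dfrac{1-q}{1+q}\bigl(1-(-q)^n\bigr)& \text{otherwise},\end{cases}\qquad\text{and}\qquad l_n=\begin{cases}(-1)^n& \text{if } n\le 0,\\ 2\,\dfrac{1-(-q)^n}{1+q}-1& \text{if } n>0.\end{cases}$$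
   Context: $T$ is a tree in which every vertex has exactly $q+1$ neighbours; $V$, $E$ are its sets of vertices and unoriented edges. $\operatorname{dist}$ is the graph distance on $V$; two edges are adjacent if they share exactly one vertex, and the distance between edges is the length of the shortest chain of adjacent edges joining them. $\Omega$ is the set of ends (equivalence classes of geodesic rays that eventually coincide). For vertices, $h(v,v_0,\omega)=\operatorname{dist}(v_0,w)-\operatorname{dist}(v,w)$ for any $w$ far enough along the ray from $v_0$ to $\omega$. For edges, $h(e,e_0,\omega)=h(v(e,\omega),v(e_0,\omega),\omega)$, where $v(e,\omega)$ is the endpoint of $e$ closer to $\omega$. The edge-horosphere tangent at $\omega$ of index $n\in\mathbb Z$ is $\mathbf h_n(\omega,e_0)=\{e\in E:h(e,e_0,\omega)=n\}$, and the edge-horospherical Radon transform is $\mathcal R_Ef(\omega,n)=\sum_{e\in\mathbf h_n(\omega,e_0)}f(e)$. A function on $E$ is radial around $e_0$ if its value at $e$ depends only on $\operatorname{dist}(e,e_0)$; then $\mathcal R_Ef(\omega,n)$ depends only on $n$.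
   Formalization: In the first choice of coefficients the vanishing condition ''n is odd or n<0'' is corrected to ''n<0'', since with l_1=0 the formula fails for q≥2 on the indicator of the edges adjacent to e_0 (it gives q-1 instead of 0). *)

(* Defs.v *)
From HB Require Import structures.
From mathcomp Require Import all_boot all_order all_algebra finmap.
From mathcomp Require Import boolp classical_sets functions cardinality fsbigop.
From mathcomp Require Import reals complex.

Set Implicit Arguments.
Unset Strict Implicit.
Unset Printing Implicit Defensive.

Import Order.TTheory GRing.Theory Num.Theory.
Local Open Scope classical_set_scope.
Local Open Scope ring_scope.

Section GraphDistance.
Context {T : eqType}.
Variable r : rel T.

Definition chain (x y : T) (n : nat) : Prop :=
  exists p : seq T, [/\ path r x p, last x p = y & size p = n].

(* Takes the junk value 0 if no chain joins x to y. *)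
Definition gdist (x y : T) : nat :=
  xget 0%N [set n | chain x y n /\ forall m, chain x y m -> (n <= m)%N].

End GraphDistance.

Record homogeneous_tree (q : nat) (V : choiceType) (adj : rel V) : Prop := {
  tree_sym : symmetric adj;
  tree_irr : irreflexive adj;
  tree_connected : forall x y : V, exists n, chain adj x y n;
  tree_acyclic : forall c : seq V, ucycle adj c -> (size c <= 2)%N;
  tree_degree : forall x : V, ([set y | adj x y] #= `I_q.+1)%card }.

Section Tree.
Context {V : choiceType}.
Variable adj : rel V.

Definition edge : choiceType :=
  {e : {fset V} | `[< exists x y, adj x y /\ e = [fset x; y]%fset >]}.

Definition edge_adj : rel edge :=
  fun e e' => #|` (val e `&` val e')%fset| == 1%N.

Definition is_ray (r : nat -> V) : Prop :=
  (forall n, adj (r n) (r n.+1)) /\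
  (forall m n, (m <= n)%N -> gdist adj (r m) (r n) = (n - m)%N).

Definition ray_equiv (r s : nat -> V) : Prop :=
  exists m n, forall k, r (m + k)%N = s (n + k)%N.

Definition tree_end : Type :=
  {w : set (nat -> V) |
    exists r, is_ray r /\ w = [set s | is_ray s /\ ray_equiv r s]}.

Definition ray_from (v0 : V) (w : tree_end) : nat -> V :=
  xget (fun=> v0) [set s | sval w s /\ s 0%N = v0].

(* The eventual value of dist(v0, x) - dist(v, x) as x runs along the ray from
   v0 to w. *)
Definition horo (v v0 : V) (w : tree_end) : int :=
  xget 0 [set n : int | exists N, forall k, (N <= k)%N ->
    let x := ray_from v0 w k in
    (gdist adj v0 x)%:Z - (gdist adj v x)%:Z = n].

Lemma edge_inhabited (e : edge) : exists v, v \in val e.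
Proof.
by case: e => e /= /asboolP [x [y [_ ->]]]; exists x; rewrite in_fset2 eqxx.
Qed.

(* v(e, w); the first argument of xget is only a default value. *)
Definition edge_end (e : edge) (w : tree_end) : V :=
  xget (xchoose (edge_inhabited e))
    [set v | v \in val e /\
             forall u, u \in val e -> u != v -> 0 < horo v u w].

Definition edge_horo (e e0 : edge) (w : tree_end) : int :=
  horo (edge_end e w) (edge_end e0 w) w.

Definition edge_horosphere (w : tree_end) (e0 : edge) (n : int) : set edge :=
  [set e | edge_horo e e0 w = n].

Definition finitely_supported (C : zmodType) (f : edge -> C) : Prop :=
  finite_set [set e | f e != 0].

Definition radial (C : Type) (e0 : edge) (f : edge -> C) : Prop :=
  forall e e', gdist edge_adj e e0 = gdist edge_adj e' e0 -> f e = f e'.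

Definition edge_radon (C : zmodType) (e0 : edge) (f : edge -> C)
    (w : tree_end) (n : int) : C :=
  \sum_(e \in edge_horosphere w e0 n) f e.

Definition inversion_coef (C : pzRingType) (e0 : edge) (l : int -> C) : Prop :=
  forall f : edge -> C, finitely_supported f -> radial e0 f ->
  forall w : tree_end,
    f e0 = \sum_(n \in [set: int]) l n * edge_radon e0 f w n.

End Tree.

(* The vanishing condition is n < 0 and not "n odd or n < 0": with l_1 = 0 the
   inversion formula fails for q >= 2 on the indicator function of the edges
   adjacent to e0, whose transform is psi_1 = 1, psi_0 = q - 1, psi_(-1) = q. *)
Definition edge_coef1 (F : fieldType) (q : nat) (n : int) : F :=
  if n < 0 then 0
  else if n == 0 then 1
  else (1 - q%:R) / (1 + q%:R) * (1 - (- q%:R) ^ n).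

Definition edge_coef2 (F : fieldType) (q : nat) (n : int) : F :=
  if n <= 0 then (-1) ^ n
  else 2 * ((1 - (- q%:R) ^ n) / (1 + q%:R)) - 1.

(* Main.v *)
(**
An end [w] orients the tree: every vertex [v] has one neighbour closer to [w],
its parent [p v], and [q] others, its children. Hence [v |-> {v, p v}] is a
bijection from vertices to edges, which turns the horospheric index of edges
into the Busemann function [b] of [w]. Let [x0] be the lower endpoint of [e0].
If the [i]-th ancestor of [v] is the [j]-th ancestor of [x0], with [i] and [j]
minimal, then the edge of [v] has horospheric index [j - i] and lies at distance
[i + j] from [e0], or [i + j - 1] when [i] and [j] are both positive. Counting
these vertices shows that the inversion formula holds as soon as [l_0 = 1] and, for all [m >= 1],
  [l_m + q^m l_(-m) + (q - 1) \sum_(i < m) q^i l_(m-1-2i) = 0],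
that is [l_m + q^m l_(-m) = (1 - q) / (1 + q) (1 - (-q)^m)]. So the values
[l_(-m)] are free, and already the choices in [{0, 1}] are uncountably many.
*)
Require Import Defs.
From mathcomp Require Import all_boot all_order all_algebra finmap.
From mathcomp Require Import boolp classical_sets functions cardinality fsbigop.
From mathcomp Require Import reals complex.
From mathcomp Require Import zify ring.

Set Implicit Arguments.
Unset Strict Implicit.
Unset Printing Implicit Defensive.

Import Order.TTheory GRing.Theory Num.Theory.
Local Open Scope classical_set_scope.
Local Open Scope ring_scope.

(** * Graph distance as the length of a shortest chain *)

Section GraphDistanceTheory.
Variables (T : eqType) (r : rel T).
Implicit Types x y z : T.

Lemma chain_cat x y z m n : chain r x y m -> chain r y z n ->
  chain r x z (m + n).
Proof.
move=> [s [rs <- <-]] [t [rt <- <-]]; exists (s ++ t).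
by rewrite cat_path rs rt last_cat size_cat.
Qed.

Lemma chain1 x y : r x y -> chain r x y 1.
Proof. by move=> xy; exists [:: y] => /=; rewrite xy. Qed.

Lemma gdistP x y n : chain r x y n ->
  chain r x y (gdist r x y) /\ forall m, chain r x y m -> (gdist r x y <= m)%N.
Proof.
move=> xyn; have ex : exists n, `[< chain r x y n >] by exists n; apply/asboolP.
rewrite /gdist; case: xgetP => [m _ //|/(_ (ex_minn ex)) []].
case: ex_minnP => m /asboolP xym min; split=> // k xyk.
by apply: min; apply/asboolP.
Qed.

Lemma gdist_eq x y n : chain r x y n -> (forall m, chain r x y m -> (n <= m)%N) ->
  gdist r x y = n.
Proof.
move=> xyn min; have [xyd /(_ _ xyn) le] := gdistP xyn.
by apply/eqP; rewrite eqn_leq le min.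
Qed.

Lemma chain_lipschitz (phi : T -> nat) x y n :
  (forall u v, r u v -> (phi u <= (phi v).+1)%N) ->
  chain r x y n -> (phi x <= phi y + n)%N.
Proof.
move=> lip [s [rs <- <-]]; elim: s x rs => [x|u s IH x /= /andP[xu us]].
  by rewrite addn0.
by have := IH _ us; have := lip _ _ xu; lia.
Qed.

(** A potential that changes by at most one along each step bounds the length of every chain to [y]
    from below; following its descent from [x] produces a chain that attains the bound. *)
Lemma gdist_potential (phi : T -> nat) x y :
  (forall u v, r u v -> (phi u <= (phi v).+1)%N) ->
  (forall u, phi u = 0%N -> u = y) -> phi y = 0%N ->
  (forall u, (0 < phi u)%N -> exists2 v, r u v & phi u = (phi v).+1) ->
  gdist r x y = phi x.
Proof.
move=> lip inj0 phiy desc; apply: gdist_eq; last first.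
  by move=> m /(chain_lipschitz lip); rewrite phiy.
move: {2}(phi x) (erefl (phi x)) => n; elim: n x => [|n IH] x phix.
  by rewrite phix (inj0 x phix); exists [::].
have [|v xv] := desc x; first by rewrite phix.
rewrite phix => -[/esym vn]; rewrite -vn -[(phi v).+1]add1n vn.
by apply: chain_cat (chain1 xv) _; rewrite -{1}vn; exact: IH.
Qed.

End GraphDistanceTheory.

(** Induction on the gap [B - a N]: if [a] is not constant from [N] on, some later value narrows the
    gap. *)
Lemma nondecreasing_bounded_stationary (a : nat -> nat) (B : nat) :
  (forall n, (a n <= a n.+1)%N) -> (forall n, (a n <= B)%N) ->
  exists N, forall k, (N <= k)%N -> a k = a N.
Proof.
move=> inc bnd.
have mono m n : (m <= n)%N -> (a m <= a n)%N.
  by move=> /subnK <-; elim: (n - m)%N => // k /leq_trans; apply; exact: inc.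
suff H m N : (B - a N <= m)%N -> exists N, forall k, (N <= k)%N -> a k = a N.
  exact: (H B 0%N (leq_subr _ _)).
elim: m N => [|m IH] N leN.
  by exists N => k /mono; have := bnd k; have := bnd N; lia.
have [//|/existsNP[k /not_implyP[Nk /eqP ne]]] :=
  pselect (forall k, (N <= k)%N -> a k = a N).
  by exists N.
by apply: (IH k); have := mono _ _ Nk; have := bnd k; lia.
Qed.

(** * Geodesics in the tree *)

Section Tree.
Variables (q : nat) (V : choiceType) (adj : rel V).
Hypothesis hT : homogeneous_tree q adj.
Local Notation d := (gdist adj).

Lemma gdist_chain x y : chain adj x y (d x y).
Proof. by have [n /gdistP[]] := tree_connected hT x y. Qed.

(* [chain] restated at the sort of [V], so that [lia] identifies the sizes. *)
Lemma geodesic x y : exists s : seq V,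
  [/\ path adj x s, last x s = y & size s = d x y].
Proof. exact: gdist_chain. Qed.

Lemma gdist_min x y n : chain adj x y n -> (d x y <= n)%N.
Proof. by move=> xy; have [_] := gdistP xy; apply. Qed.

Lemma gdist_triangle x y z : (d x z <= d x y + d y z)%N.
Proof. by apply: gdist_min; apply: chain_cat; exact: gdist_chain. Qed.

Lemma gdist_adj x y z : adj x y -> (d x z <= (d y z).+1)%N.
Proof.
by move=> xy; rewrite -add1n; apply: gdist_min;
  apply: chain_cat (chain1 xy) _; exact: gdist_chain.
Qed.

Lemma gdist_sym x y : d x y = d y x.
Proof.
suff H u v : (d u v <= d v u)%N by apply/eqP; rewrite eqn_leq !H.
apply: gdist_min; have [s [vs <- <-]] := geodesic v u.
exists (rev (belast v s)); rewrite size_rev size_belast; split=> //.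
  by rewrite rev_path (eq_path (e' := adj)) // => ? ?; rewrite (tree_sym hT).
case: s {vs} => //= w s; rewrite rev_cons last_rcons //.
Qed.

(** Otherwise the path, made free of repetitions, would close up through [v] to a cycle with at
    least three vertices. *)
Lemma neighbour_separation v u u' s : adj v u -> adj v u' ->
  path adj u s -> last u s = u' -> v \notin u :: s -> u = u'.
Proof.
move=> vu vu' us lst; case: (shortenP us) lst => t ut utu sub lst vs.
case: t ut utu sub lst => [|w t] ut utu sub lst //.
have : ucycle adj (v :: u :: w :: t).
  apply/andP; split; last first.
    rewrite cons_uniq utu andbT; apply: contra vs.
    rewrite inE => /orP[/eqP->|/sub vs]; first exact: mem_head.
    by rewrite inE vs orbT.
  have -> : cycle adj [:: v, u, w & t] = path adj v (rcons [:: u, w & t] v).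
    by [].
  move: ut lst => /= /andP[uw wt] lst.
  by rewrite rcons_path /= vu uw wt lst (tree_sym hT).
by move/(tree_acyclic hT).
Qed.

Lemma geodesic_below x u : exists s, [/\ path adj u s, last u s = x &
  forall y, y \in s -> (d y x < d u x)%N].
Proof.
have [s [us lst sz]] := geodesic u x; exists s; split=> // y ys.
case/splitPr: ys us lst sz => s1 s2.
rewrite cat_path last_cat size_cat /= => /and3P[_ _ ys2] lst <-.
have : (d y x <= size s2)%N by apply: gdist_min; exists s2.
by rewrite -ltnS => /leq_trans; apply; exact: leq_addl.
Qed.

(** All vertices on the geodesics from [u] and [u'] to [x], after the first, are strictly nearer to
    [x] than [v]. Joined at [x], the geodesics connect [u] to [u'] without meeting [v]. *)
Lemma neighbour_towards_unique x v u u' : adj v u -> adj v u' ->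
  (d u x <= d v x)%N -> (d u' x <= d v x)%N -> u = u'.
Proof.
move=> vu vu' lu lu'.
have [s [us ls bs]] := geodesic_below x u.
have [t [ut lt bt]] := geodesic_below x u'.
have nv z : adj v z -> v != z.
  by move=> vz; apply/eqP => E; have := tree_irr hT v; rewrite {2}E vz.
apply: (@neighbour_separation v u u' (s ++ rev (belast u' t))) => //.
- rewrite cat_path us ls -lt rev_path (eq_path (e' := adj)) //.
  by move=> ? ?; rewrite (tree_sym hT).
- rewrite last_cat ls -lt.
  by case: (t) => //= w t'; rewrite rev_cons last_rcons.
- rewrite inE mem_cat mem_rev !negb_or nv //=; apply/andP; split.
    by apply/negP => /bs; lia.
  apply/negP => /mem_belast; rewrite inE (negPf (nv _ vu')) /= => /bt; lia.
Qed.

(** * The Busemann function of an end and its parent map *)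

Section Busemann.
Variable r : nat -> V.
Hypothesis ray_r : is_ray adj r.

(** By the triangle inequality the sequence is nondecreasing and bounded, so its eventual value is
    also its maximum. *)
Lemma busemann_exists v : exists n : int,
  (forall k, k%:Z - (d v (r k))%:Z <= n) /\
  (exists N, forall k, (N <= k)%N -> k%:Z - (d v (r k))%:Z = n).
Proof.
(* The shift by [d v (r 0)] keeps the sequence natural-valued: by [le1] the subtraction never
   truncates. *)
pose a k := (d v (r 0%N) + k - d v (r k))%N.
have le1 k : (d v (r k) <= d v (r 0%N) + k)%N.
  have := gdist_triangle v (r 0%N) (r k); rewrite (ray_r.2 0%N k) //; lia.
have inc k : (a k <= a k.+1)%N.
  have := gdist_triangle v (r k) (r k.+1).
  by rewrite (ray_r.2 k k.+1) // /a; have := le1 k; lia.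
have bnd k : (a k <= 2 * d v (r 0%N))%N.
  have := gdist_triangle (r 0%N) v (r k).
  by rewrite (ray_r.2 0%N k) // gdist_sym /a; lia.
have [N st] := nondecreasing_bounded_stationary inc bnd.
have mono m n : (m <= n)%N -> (a m <= a n)%N.
  by move=> /subnK <-; elim: (n - m)%N => // k /leq_trans; apply; exact: inc.
exists ((a N)%:Z - (d v (r 0%N))%:Z); split=> [k|].
  have := le1 k; have [/st|/ltnW /mono] := leqP N k; rewrite /a; lia.
by exists N => k /st; have := le1 k; have := le1 N; rewrite /a; lia.
Qed.

End Busemann.

(** Only differences of [b] are tied to [w], so [b] is the Busemann function up to an additive
    constant. *)
Record horofunction (w : tree_end adj) (b : V -> int) (p : V -> V) : Prop := {
  horofunction_horo : forall v u, horo v u w = b v - b u;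
  adj_parent : forall v, adj v (p v);
  height_parent : forall v, b (p v) = b v + 1;
  neighbour_parent : forall v u, adj v u -> u = p v \/ p u = v;
  parent_confluent : forall u v, exists i j, iter i p u = iter j p v }.

Lemma horofunction_exists (w : tree_end adj) : exists b p, horofunction w b p.
Proof.
have [W [r [ray_r WE]] wE] : exists2 W,
    exists r, is_ray adj r /\ W = [set s | is_ray adj s /\ ray_equiv r s] &
    sval w = W.
  by exists (sval w) => //; exact: (svalP w).
have [b bP] := choice (busemann_exists ray_r).
have b_le v k : k%:Z - (d v (r k))%:Z <= b v by case: (bP v).
have b_eq v : exists N, forall k, (N <= k)%N -> k%:Z - (d v (r k))%:Z = b v.
  by case: (bP v).
have lip u v : adj u v -> b u <= b v + 1.
  move=> uv; have [N /(_ N (leqnn _)) <-] := b_eq u; have := b_le v N.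
  by move: uv; rewrite (tree_sym hT) => /(@gdist_adj v u (r N)); lia.
have up v : exists u, adj v u /\ b u = b v + 1.
  (* Taking [k] beyond [b v] makes [d v (r k)] positive, so the geodesic from [v] to [r k] has a
     first step; that step raises [b] by one. *)
  have [N bN] := b_eq v; have [k [/bN bk bvk]] : exists k, (N <= k)%N /\ b v < k%:Z.
    by exists (N + `|b v|.+1)%N; split; lia.
  have [[|u s] [vs lst sz]] := geodesic v (r k); first by move: sz bk => /=; lia.
  move: vs sz => /= /andP[vu us] sz; exists u; split=> //.
  have : (d u (r k) <= size s)%N by apply: gdist_min; exists s.
  have := b_le u k; have := lip u v; rewrite (tree_sym hT) vu => /(_ isT); lia.
have [p pP] := choice up.
have p_adj v : adj v (p v) by case: (pP v).
have bp v : b (p v) = b v + 1 by case: (pP v).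
(* For [k] large, both [u] and [p v] are no farther from [r k] than [v], and only one neighbour can
   be. *)
have p_unique v u : adj v u -> b v <= b u -> u = p v.
  move=> vu le; have [Nv bv] := b_eq v; have [Nu bu] := b_eq u.
  have [Np bpv] := b_eq (p v).
  have [k [kv ku kp]] : exists k,
      [/\ (Nv <= k)%N, (Nu <= k)%N & (Np <= k)%N].
    by exists (Nv + Nu + Np)%N; split; lia.
  have := bv k kv; have := bu k ku; have := bpv k kp; rewrite bp => h1 h2 h3.
  by apply: (@neighbour_towards_unique (r k)) vu (p_adj v) _ _; lia.
have b_ray k : b (r k) = k%:Z.
  have [N /(_ (N + k)%N)] := b_eq (r k); rewrite ray_r.2 ?leq_addl //; lia.
have lip_path v s : path adj v s -> b (last v s) <= b v + (size s)%:Z.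
  elim: s v => [v _|u s IH v /= /andP[vu us]] /=; first lia.
  by have := IH _ us; have := lip u v; rewrite (tree_sym hT) vu; lia.
have climb v s : path adj v s -> b (last v s) = b v + (size s)%:Z ->
    last v s = iter (size s) p v.
  elim: s v => // u s IH v /= /andP[vu us] E.
  have le := lip_path _ _ us.
  have := lip u v; rewrite (tree_sym hT) vu => /(_ isT) lu.
  have uE : u = p v by apply: p_unique => //; lia.
  have bu : b u = b v + 1 by rewrite uE bp.
  rewrite IH //; last by move: E; lia.
  by rewrite uE -iterSr.
(* For [N] in the stationary range, the geodesic from [v] to [r N] gains one unit of height at every
   step, so it climbs along parents. *)
have reach v : exists i k, iter i p v = r k.
  have [N /(_ N (leqnn _)) bN] := b_eq v.
  have [s [vs lst sz]] := geodesic v (r N); exists (size s), N.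
  by rewrite -climb ?lst // b_ray; lia.
have p_ray k : p (r k) = r k.+1.
  by apply/esym/p_unique; [exact: ray_r.1|rewrite !b_ray; lia].
have iter_ray i k : iter i p (r k) = r (i + k)%N by elim: i => //= i ->.
exists b, p; split=> // [v u|v u vu|u v].
- have Ws s : W s -> exists m n, forall k, r (m + k)%N = s (n + k)%N.
    by rewrite WE => -[_].
  (* [ray_from] picks some ray of the class that starts at [u]; the orbit of [u] under [p] shows
     that one exists. Afterwards only its eventual agreement with [r] matters. *)
  have [s [sP s0]] : exists s, W s /\ s 0%N = u.
    have [i [k ik]] := reach u; exists (fun n => iter n p u); split=> //.
    have b_iter n x : b (iter n p x) = b x + n%:Z.
      by elim: n => /= [|n IHn]; rewrite ?bp ?IHn; lia.
    rewrite WE /=; split; last first.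
      by exists k, i => n; rewrite [(i + n)%N]addnC iterD ik iter_ray addnC.
    split=> [n|m n mn]; first exact: p_adj.
    have lipn x y n' : chain adj x y n' -> b y <= b x + n'%:Z.
      by move=> [t [xt <- <-]]; exact: lip_path.
    apply: gdist_eq.
      rewrite -{1}(subnK mn) iterD; elim: (n - m)%N => [|l IHl].
        by exists [::].
      by have := chain_cat IHl (chain1 (p_adj _)); rewrite addn1.
    by move=> l /lipn; rewrite !b_iter; lia.
  pose S := [set s | sval w s /\ s 0%N = u].
  have [+ _] : S (ray_from u w).
    by apply: (@xgetPex _ _ S); exists s; rewrite /S /= wE.
  rewrite wE => /Ws[m [n mn]].
  have lim : exists N, forall k, (N <= k)%N -> let x := ray_from u w k in
      (d u x)%:Z - (d v x)%:Z = b v - b u.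
    have [Nu bu] := b_eq u; have [Nv bv] := b_eq v.
    exists (n + Nu + Nv)%N => k kN /=.
    have -> : k = (n + (k - n))%N by lia.
    rewrite -mn; have := bu (m + (k - n))%N; have := bv (m + (k - n))%N; lia.
  rewrite /horo; case: xgetP => [z _ [N zN]|/(_ (b v - b u))]; last by case.
  have [N' lim'] := lim.
  by rewrite -(zN (N + N')%N) ?leq_addr // lim' // leq_addl.
- have [le|lt] := leP (b v) (b u); first by left; exact: p_unique.
  by right; apply/esym/p_unique; [rewrite (tree_sym hT)|exact: ltW].
- have [i [k ik]] := reach u; have [j [l jl]] := reach v.
  exists (l + i)%N, (k + j)%N; rewrite !iterD ik jl !iter_ray addnC //.
Qed.

End Tree.

(** * Indices of the edges on a sphere around the reference edge *)

Lemma uniq_flatten_map (K T : eqType) (F : K -> seq T) (key : T -> K)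
    (s : seq K) : uniq s -> (forall a, uniq (F a)) ->
  (forall a x, x \in F a -> key x = a) -> uniq (flatten [seq F a | a <- s]).
Proof.
move=> + uF keyF; elim: s => //= a s IH /andP[as_ us].
rewrite cat_uniq uF IH // andbT; apply/hasPn => x /flatten_mapP[c cs xc].
by apply: contra as_ => xa; rewrite -(keyF _ _ xa) (keyF _ _ xc).
Qed.

(* [(i, j)] stands for the vertices whose [i]-th ancestor is the [j]-th
   ancestor of the lower endpoint of [e0], with [i] and [j] minimal; [index_dist]
   is the distance to [e0] of the edge from such a vertex to its parent. *)
Definition index_dist (a : nat * nat) : nat :=
  (a.1 + a.2 - ((0 < a.1) && (0 < a.2)))%N.

(** The number of vertices with index [a]. The factor [q.-1] leaves out, among the children of the
    meeting vertex, the one on the path up from the lower endpoint of [e0]. *)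
Definition index_weight (q : nat) (a : nat * nat) : nat :=
  match a with
  | (i, 0%N) => (q ^ i)%N
  | (0%N, _.+1) => 1%N
  | (i.+1, _.+1) => (q.-1 * q ^ i)%N
  end.

(** The coordinates of [(i.+1, m - i)] add up to [m.+1]: two branches meet in sibling edges, which
    are adjacent, and this saves one step. *)
Definition sphere_indices (m : nat) : seq (nat * nat) :=
  if m is n.+1 then
    [:: (m, 0), (0, m) & [seq (i.+1, m - i) | i <- iota 0 m]]%N
  else [:: (0, 0)]%N.

Lemma mem_branch_indices m i j :
  ((i, j) \in [seq (i.+1, m - i)%N | i <- iota 0 m])
  = [&& (0 < i)%N, (0 < j)%N & (i + j == m.+1)%N].
Proof.
apply/mapP/idP => [[k]|h]; first by rewrite mem_iota => + [-> ->]; lia.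
by exists i.-1; [rewrite mem_iota; lia|congr (_, _); lia].
Qed.

Lemma mem_sphere_indices m a : (a \in sphere_indices m) = (index_dist a == m).
Proof.
case: m a => [|m] [i j]; rewrite /index_dist /sphere_indices.
  by rewrite inE xpair_eqE; case: i j => [|i] [|j] /=; lia.
rewrite 2!in_cons !xpair_eqE mem_branch_indices.
by case: i j => [|i] [|j] /=; lia.
Qed.

Lemma sphere_indices_uniq m : uniq (sphere_indices m).
Proof.
case: m => [//|m]; rewrite /sphere_indices 2!cons_uniq map_inj_uniq ?iota_uniq.
  by rewrite in_cons !mem_branch_indices xpair_eqE; lia.
by move=> i k [].
Qed.

(** The value of the inversion sum with coefficients [l] on the indicator function of the edges at
    distance [m] from [e0]. *)
Definition sphere_sum (C : pzRingType) (q m : nat) (l : int -> C) : C :=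
  \sum_(a <- sphere_indices m) (index_weight q a)%:R * l (a.2%:Z - a.1%:Z).

(** * Edges as vertices joined to their parents *)

Section Horospheres.
Variables (q : nat) (V : choiceType) (adj : rel V).
Hypothesis hT : homogeneous_tree q adj.
Variables (w : tree_end adj) (b : V -> int) (p : V -> V).
Hypothesis hb : horofunction w b p.

Lemma height_iter n v : b (iter n p v) = b v + n%:Z.
Proof. by elim: n => /= [|n IH]; rewrite ?(height_parent hb) ?IH; lia. Qed.

Lemma parent_neq v : p v != v.
Proof. by apply/eqP => /(congr1 b); rewrite (height_parent hb); lia. Qed.

Lemma parent2_neq v : p (p v) != v.
Proof. by apply/eqP => /(congr1 b); rewrite !(height_parent hb); lia. Qed.

Lemma parent_edge_subproof v :
  `[< exists x y, adj x y /\ [fset v; p v]%fset = [fset x; y]%fset >].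
Proof. by apply/asboolP; exists v, (p v); split=> //; exact: adj_parent hb v. Qed.

Definition parent_edge v : edge adj :=
  exist _ [fset v; p v]%fset (parent_edge_subproof v).
Local Notation E := parent_edge.

Lemma parent_edge_inj : injective E.
Proof.
move=> u v /(congr1 val) /= uv.
have : u \in [fset v; p v]%fset by rewrite -uv in_fset2 eqxx.
move=> /fset2P[//|uE].
have : v \in [fset u; p u]%fset by rewrite uv in_fset2 eqxx.
move=> /fset2P[//|vE]; have := parent2_neq v.
by rewrite -uE -vE eqxx.
Qed.

Lemma parent_edge_surj e : exists v, E v = e.
Proof.
case: e => e he; have [x [y [xy eE]]] := asboolW he.
have [yE|xE] := neighbour_parent hb xy; [exists x|exists y]; apply: val_inj => /=.
  by rewrite eE yE.
by rewrite eE xE fsetUC.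
Qed.

Lemma edge_end_parent_edge v : edge_end (E v) w = p v.
Proof.
rewrite /edge_end; case: xgetP => [u _ [/fset2P[->|//] up]|/(_ (p v)) []].
  have := up (p v); rewrite in_fset2 eqxx orbT parent_neq => /(_ isT isT).
  by rewrite (horofunction_horo hb) (height_parent hb); lia.
split=> [|u /fset2P[->|->]]; rewrite ?eqxx //; first by rewrite in_fset2 eqxx orbT.
by move=> _; rewrite (horofunction_horo hb) (height_parent hb); lia.
Qed.

Lemma edge_horo_parent_edge u v : edge_horo (E u) (E v) w = b u - b v.
Proof.
rewrite /edge_horo !edge_end_parent_edge (horofunction_horo hb).
by rewrite !(height_parent hb); lia.
Qed.

Lemma edge_adj_sym : symmetric (@edge_adj V adj).
Proof. by move=> e e'; rewrite /edge_adj fsetIC. Qed.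

Lemma edge_adj_parent u : edge_adj (E u) (E (p u)).
Proof.
apply/cardfs1P; exists (p u); apply/fsetP => x; rewrite !inE.
apply/andP/eqP => [[/orP[/eqP->|/eqP->//]]|->]; last by rewrite eqxx orbT.
by rewrite eq_sym (negPf (parent_neq u)) eq_sym (negPf (parent2_neq u)).
Qed.

Lemma edge_adj_sibling u v : u != v -> p u = p v -> edge_adj (E u) (E v).
Proof.
move=> uv puv; apply/cardfs1P; exists (p u); apply/fsetP => x; rewrite !inE -puv.
apply/andP/eqP => [[/orP[/eqP->|/eqP->//]]|->]; last by rewrite eqxx !orbT.
by rewrite (negPf uv) eq_sym (negPf (parent_neq u)).
Qed.

Lemma edge_adjE u v : edge_adj (E u) (E v) -> [\/ p u = v, p v = u | p u = p v].
Proof.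
move=> /cardfs1P[x xE]; have : x \in (val (E u) `&` val (E v))%fset.
  by rewrite xE inE.
rewrite !inE => /andP[/orP[]/eqP-> /orP[]/eqP];
  [|by constructor 2|by constructor|by constructor 3].
move=> uv; move: xE; rewrite uv fsetIid /= => /(congr1 (fun A => #|` A|)%fset).
by rewrite cardfs2 cardfs1 eq_sym parent_neq.
Qed.

(** * Where the ascending paths of two vertices meet, and edge distances *)

Section Confluence.
Variable x0 : V.

(** The second clause is minimality: paths that have met stay together, so it suffices that they
    differ one step earlier. *)
Definition confluent_at v (a : nat * nat) : Prop :=
  iter a.1 p v = iter a.2 p x0 /\
  ((0 < a.1)%N -> (0 < a.2)%N -> iter a.1.-1 p v <> iter a.2.-1 p x0).

Lemma confluent_at_exists v : exists a, confluent_at v a.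
Proof.
have ex : exists i, `[< exists j, iter i p v = iter j p x0 >].
  by have [i [j ij]] := parent_confluent hb v x0; exists i; apply/asboolP; exists j.
case: (ex_minnP ex) => i /asboolP[j ij] min; exists (i, j); split=> //= i0 j0 E'.
suff : (i <= i.-1)%N by lia.
by apply: min; apply/asboolP; exists j.-1.
Qed.

Lemma confluent_at_unique v a c : confluent_at v a -> confluent_at v c -> a = c.
Proof.
wlog ac : a c / (a.1 <= c.1)%N => [H|].
  by move=> ha hc; have [/H->//|/ltnW/H H'] := leqP a.1 c.1; apply/esym/H'.
case: a c ac => i j [k l] /= ik [/= ij _] [/= kl min].
(* Heights force [j - i = l - k]. If [i < k], the paths have met at [(i, j)], hence also at
   [(k.-1, l.-1)], against minimality. *)
have := congr1 b ij; have := congr1 b kl; rewrite !height_iter => h1 h2.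
have [ik'|ne] := eqVneq i k; first by congr (_, _); lia.
case: min; [lia|lia|].
have -> : k.-1 = (k.-1 - i + i)%N by lia.
have -> : l.-1 = (k.-1 - i + j)%N by lia.
by rewrite !iterD ij.
Qed.

Definition confluence v : nat * nat := xget (0, 0)%N [set a | confluent_at v a].

Lemma confluenceP v : confluent_at v (confluence v).
Proof.
have [a ha] := confluent_at_exists v.
by rewrite /confluence; apply: (@xgetPex _ _ [set a | confluent_at v a]); exists a.
Qed.

Lemma confluence_eq v a : confluent_at v a -> confluence v = a.
Proof. exact: confluent_at_unique (confluenceP v). Qed.

Lemma confluence_iter j : confluence (iter j p x0) = (0, j)%N.
Proof. exact: confluence_eq. Qed.

Lemma confluence_parentS v i j : confluence v = (i.+1, j) ->
  confluence (p v) = (i, j).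
Proof.
move=> vE; have := confluenceP v; rewrite vE => -[/= h1 h2].
apply: confluence_eq; split; rewrite /= -?iterSr //.
by move=> i0 j0; rewrite prednK //; apply: h2.
Qed.

Lemma confluence0 v j : confluence v = (0, j)%N -> v = iter j p x0.
Proof. by move=> vE; have := confluenceP v; rewrite vE => -[]. Qed.

Lemma confluence_parent0 v j : confluence v = (0, j)%N ->
  confluence (p v) = (0, j.+1)%N.
Proof. by move=> /confluence0->; exact: (confluence_iter j.+1). Qed.

Lemma height_confluence v :
  b v - b x0 = (confluence v).2%:Z - (confluence v).1%:Z.
Proof. by have [/(congr1 b)] := confluenceP v; rewrite !height_iter; lia. Qed.

(** [index_dist] is a potential in the sense of [gdist_potential]: adjacent edges are parent and
    child or siblings, so it changes by at most one. *)
Lemma gdist_parent_edge v :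
  gdist (@edge_adj V adj) (E v) (E x0) = index_dist (confluence v).
Proof.
have [low lowK] := choice parent_edge_surj.
have lowE u : low (E u) = u by apply: parent_edge_inj.
pose phi e := index_dist (confluence (low e)).
rewrite (@gdist_potential _ _ phi); rewrite /phi ?lowE // {phi v}.
- move=> e e'; rewrite -{1}(lowK e) -{1}(lowK e').
  move: (low e) (low e') => u v /edge_adjE uv.
  case uE: (confluence u) => [[|i] j]; case vE: (confluence v) => [[|k] l];
  case: uv => /(congr1 confluence);
  rewrite ?(confluence_parentS uE) ?(confluence_parentS vE)
    ?(confluence_parent0 uE) ?(confluence_parent0 vE) ?uE ?vE => -[];
  rewrite /index_dist /=; lia.
- move=> e; rewrite -{2}(lowK e); case eE: (confluence (low e)) => [i j] h.
  have [i0 j0] : i = 0%N /\ j = 0%N by move: h; rewrite /index_dist /=; lia.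
  by rewrite i0 j0 in eE; rewrite (confluence0 eE).
- by rewrite (confluence_iter 0).
- move=> e; rewrite -{2}(lowK e); move: (low e) => v.
  case vE: (confluence v) => [[|i] j].
    case: j vE => // j vE _; exists (E (iter j p x0)).
      by rewrite edge_adj_sym (confluence0 vE); exact: edge_adj_parent.
    by rewrite lowE confluence_iter /index_dist /=; lia.
  (* At an index [(1, j.+1)] the parent edge is no nearer to [e0]; the jump to the sibling edge
     above [x0] lowers both coordinates. *)
  have [/andP[/eqP i0 j0] _|h _] := boolP ((i == 0)%N && (0 < j)%N); last first.
    exists (E (p v)); first exact: edge_adj_parent.
    by rewrite lowE (confluence_parentS vE) /index_dist /=; lia.
  case: j vE j0 => // j vE _; rewrite i0 in vE *.
  have := confluenceP v; rewrite vE => -[/= h1 h2].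
  exists (E (iter j p x0)); first by apply: edge_adj_sibling => //; apply/eqP/h2.
  by rewrite lowE confluence_iter /index_dist /=; lia.
Qed.

(** * Counting descendants and the vertices with a given index *)

Definition children v : seq V := (fset_set [set u | adj v u] `\ p v)%fset.

Lemma finite_neighbours v : finite_set [set u | adj v u].
Proof. by apply/finite_setP; exists q.+1; exact: tree_degree hT v. Qed.

Lemma mem_children u v : (u \in children v) = (p u == v).
Proof.
rewrite !inE in_fset_set; last exact: finite_neighbours.
apply/andP/eqP => [[uv]|<-].
  by rewrite inE /= => /(neighbour_parent hb)[uE|//]; rewrite uE eqxx in uv.
by rewrite eq_sym parent2_neq inE /= (tree_sym hT) (adj_parent hb).
Qed.

Lemma children_uniq v : uniq (children v).
Proof. exact: fset_uniq. Qed.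

Lemma size_children v : size (children v) = q.
Proof.
have := card_fset_set (tree_degree hT v).
rewrite (cardfsD1 (p v)) in_fset_set; last exact: finite_neighbours.
by rewrite mem_set /= ?(adj_parent hb) // => -[].
Qed.

Lemma degree_gt0 : (0 < q)%N.
Proof.
rewrite -(size_children (p x0)).
have : x0 \in children (p x0) by rewrite mem_children.
by case: children.
Qed.

Definition down (s : seq V) : seq V := flatten [seq children v | v <- s].

Lemma mem_iter_down i s v : (v \in iter i down s) = (iter i p v \in s).
Proof.
elim: i v => // i IH v; rewrite [in RHS]iterSr -IH iterS.
apply/flatten_mapP/idP => [[u us]|pv].
  by rewrite mem_children => /eqP->.
by exists (p v); rewrite ?mem_children.
Qed.

Lemma iter_down_uniq i s : uniq s -> uniq (iter i down s).
Proof.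
move=> us; elim: i => //= i IH; apply: (uniq_flatten_map (key := p)) => //.
  exact: children_uniq.
by move=> v u; rewrite mem_children => /eqP.
Qed.

Lemma size_iter_down i s : size (iter i down s) = (size s * q ^ i)%N.
Proof.
elim: i => [|i IH]; first by rewrite muln1.
rewrite expnS mulnCA -IH /= size_flatten /shape -map_comp.
elim: (iter i down s) => [|v t IHt] /=; first by rewrite muln0.
by rewrite IHt size_children mulnS.
Qed.

(** [rem] deletes the child through which [x0] climbs, as minimality of the index requires. *)
Definition confluence_class (a : nat * nat) : seq V :=
  match a with
  | (i, 0%N) => iter i down [:: x0]
  | (0%N, j.+1) => [:: iter j.+1 p x0]
  | (i.+1, j.+1) => iter i down (rem (iter j p x0) (children (iter j.+1 p x0)))
  end.

Lemma confluence_class0 i : confluence_class (i, 0%N) = iter i down [:: x0].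
Proof. by case: i. Qed.

Lemma mem_confluence_class a v : (v \in confluence_class a) = (confluence v == a).
Proof.
apply/idP/eqP => [h|<-].
  apply: confluence_eq; case: a h => [i [|j]].
    by rewrite confluence_class0 mem_iter_down inE => /eqP; split.
  case: i => [|i]; first by rewrite inE => /eqP->; split.
  rewrite /confluence_class mem_iter_down mem_rem_uniq ?children_uniq //
    inE /= mem_children.
  by move=> /andP[/eqP ne /eqP eq_]; split.
have := confluenceP v; case: (confluence v) => [i [|j]] [h1 h2].
  by rewrite confluence_class0 mem_iter_down inE h1.
case: i h1 h2 => [|i] h1 h2; first by rewrite inE -h1.
rewrite /confluence_class mem_iter_down mem_rem_uniq ?children_uniq //
    inE /= mem_children [p _]h1 eqxx.
by rewrite andbT; apply/eqP/h2.
Qed.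

Lemma confluence_class_uniq a : uniq (confluence_class a).
Proof.
by case: a => [[|i] [|j]] //=; [apply: (@iter_down_uniq i.+1)|
  apply/iter_down_uniq/rem_uniq/children_uniq].
Qed.

Lemma size_confluence_class a : size (confluence_class a) = index_weight q a.
Proof.
case: a => [[|i] [|j]] //; rewrite /confluence_class.
  by rewrite size_iter_down mul1n.
by rewrite size_iter_down size_rem ?size_children // mem_children.
Qed.

(** Edges at distance less than [N] from [e0], listed through their lower endpoints. *)
Definition edge_ball (N : nat) : seq V :=
  flatten [seq flatten [seq confluence_class a | a <- sphere_indices m]
            | m <- iota 0 N].

Lemma mem_edge_sphere m v :
  (v \in flatten [seq confluence_class a | a <- sphere_indices m])
  = (index_dist (confluence v) == m).
Proof.
rewrite -mem_sphere_indices; apply/flatten_mapP/idP => [[a am]|vm].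
  by rewrite mem_confluence_class => /eqP->.
by exists (confluence v); rewrite ?mem_confluence_class.
Qed.

Lemma mem_edge_ball N v : (v \in edge_ball N) = (index_dist (confluence v) < N)%N.
Proof.
apply/flatten_mapP/idP => [[m]|vN].
  by rewrite mem_iota mem_edge_sphere => mN /eqP->.
by exists (index_dist (confluence v)); rewrite ?mem_edge_sphere // mem_iota.
Qed.

Lemma edge_ball_uniq N : uniq (edge_ball N).
Proof.
apply: (uniq_flatten_map (key := fun v => index_dist (confluence v))).
- exact: iota_uniq.
- move=> m; apply: (uniq_flatten_map (key := confluence)).
  + exact: sphere_indices_uniq.
  + exact: confluence_class_uniq.
  + by move=> a v; rewrite mem_confluence_class => /eqP.
- by move=> m v; rewrite mem_edge_sphere => /eqP.
Qed.

(** Both factors are constant on each confluence class, which therefore contributes its size times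
    their product. *)
Lemma edge_ball_sum (C : comPzRingType) (g : nat -> C) (l : int -> C) N :
  \sum_(v <- edge_ball N) l (b v - b x0) * g (index_dist (confluence v))
  = \sum_(m < N) g m * sphere_sum q m l.
Proof.
rewrite /edge_ball big_flatten big_map -(big_mkord xpredT
  (fun m => g m * sphere_sum q m l)) /index_iota subn0; apply: eq_bigr => m _.
rewrite big_flatten big_map mulr_sumr; apply: eq_big_seq => a.
rewrite mem_sphere_indices => /eqP am.
rewrite (eq_big_seq (fun=> l (a.2%:Z - a.1%:Z) * g m)); last first.
  by move=> v; rewrite mem_confluence_class height_confluence => /eqP->; rewrite am.
rewrite big_const_seq count_predT size_confluence_class iter_addr_0.
by rewrite -mulr_natl; ring.
Qed.

(** * The Radon transform of a radial function, for one end *)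

Section Radon.
Variables (C : comPzRingType) (f : edge adj -> C) (g : nat -> C) (N : nat).
Hypothesis fE : forall e, f e = g (gdist (@edge_adj V adj) e (E x0)).
Hypothesis g0 : forall m, (N <= m)%N -> g m = 0.

Lemma edge_radon_ball n : edge_radon (E x0) f w n
  = \sum_(v <- edge_ball N | b v - b x0 == n) g (index_dist (confluence v)).
Proof.
have bij : set_bij [set v | b v - b x0 == n] (edge_horosphere w (E x0) n) E.
  split=> [v /eqP vn|u v _ _|e].
  - by rewrite /edge_horosphere /= edge_horo_parent_edge.
  - exact: parent_edge_inj.
  - have [v <-] := parent_edge_surj e.
    by rewrite /edge_horosphere /= edge_horo_parent_edge => vn; exists v => //; apply/eqP.
rewrite /edge_radon (@reindex_fsbig _ _ _ _ _ _ _ _ _ bij)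
  [RHS]bigfs ?edge_ball_uniq //; last first.
  by move=> v _; rewrite mem_edge_ball -leqNgt => /g0.
by apply: eq_fsbigr => v _; rewrite fE gdist_parent_edge.
Qed.

Lemma edge_radon_sphere_sum n : edge_radon (E x0) f w n
  = \sum_(m < N) g m * sphere_sum q m (fun k => (k == n)%:R).
Proof.
rewrite edge_radon_ball -edge_ball_sum big_mkcond /=; apply: eq_bigr => v _.
by case: eqP; rewrite ?mul1r ?mul0r.
Qed.

(** The sum over [n] reduces to the finitely many heights met in the ball; after exchanging sums,
    each vertex contributes only at its own height. *)
Lemma sum_edge_radon (l : int -> C) :
  \sum_(n \in [set: int]) l n * edge_radon (E x0) f w n
  = \sum_(m < N) g m * sphere_sum q m l.
Proof.
rewrite -edge_ball_sum; set L := edge_ball N.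
rewrite (fsbigTE [fset n | n in [seq b v - b x0 | v <- L]]%fset); last first.
  move=> n; rewrite inE /= => nL; rewrite edge_radon_ball big_seq_cond big1 ?mulr0 //.
  by move=> v /andP[vL /eqP vn]; case/negP: nL; apply/mapP; exists v.
under eq_bigr do rewrite edge_radon_ball mulr_sumr.
rewrite (exchange_big_dep xpredT) //=; apply: eq_big_seq => v vL.
rewrite big_mkcond (bigD1_seq (b v - b x0)) ?fset_uniq //=; last first.
  by rewrite inE /=; apply/mapP; exists v.
rewrite eqxx big1 ?addr0 // => n; rewrite eq_sym => /negPf -> //.
Qed.

End Radon.
End Confluence.
End Horospheres.

(** * Radial functions and the criterion for inversion *)

Section RadialRadon.
Variables (q : nat) (V : choiceType) (adj : rel V).
Hypothesis hT : homogeneous_tree q adj.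
Variable e0 : edge adj.
Local Notation dist := (gdist (@edge_adj V adj)).

Lemma tree_end_degree_gt0 : tree_end adj -> (0 < q)%N.
Proof.
move=> w; have [b [p hb]] := horofunction_exists hT w.
by have [x0 _] := edge_inhabited e0; exact: (degree_gt0 hT hb x0).
Qed.

(** The edges above the successive ancestors of [x0] realise every distance from [e0], so [g] is
    read off along them; [N] exceeds all distances in the support. *)
Lemma radial_profile (C : comPzRingType) (f : edge adj -> C) :
    tree_end adj -> finitely_supported f -> radial e0 f ->
  exists g N, (forall e, f e = g (dist e e0)) /\
              (forall m, (N <= m)%N -> g m = 0).
Proof.
move=> w /finite_fsetP[X XE] rad; have [b [p hb]] := horofunction_exists hT w.
have [x0 x0E] := parent_edge_surj hb e0.
pose c m := parent_edge hb (iter m p x0).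
have cE m : dist (c m) e0 = m.
  by rewrite -x0E (gdist_parent_edge hb) (confluence_iter hb) /index_dist /= subn0.
exists (f \o c), (\max_(e <- X) dist e e0).+1%N; split=> [e|m].
  by apply: rad; rewrite cE.
move=> Xm; apply/eqP/negP => /negP fm; suff: (m < m)%N by rewrite ltnn.
apply: leq_trans Xm; rewrite ltnS -{1}(cE m).
have cX : c m \in X by have : [set e | f e != 0] (c m) by []; rewrite XE.
exact: (@leq_bigmax_seq _ (enum_fset X) xpredT (fun e => dist e e0) (c m) cX isT).
Qed.

Section Profile.
Variables (C : comPzRingType) (f : edge adj -> C) (g : nat -> C) (N : nat).
Hypothesis fE : forall e, f e = g (dist e e0).
Hypothesis g0 : forall m, (N <= m)%N -> g m = 0.

(** The right-hand side does not mention [w]; this is the independence of the end. *)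
Lemma edge_radon_radial w n : edge_radon e0 f w n
  = \sum_(m < N) g m * sphere_sum q m (fun k => (k == n)%:R).
Proof.
have [b [p hb]] := horofunction_exists hT w.
have [x0 x0E] := parent_edge_surj hb e0; move: fE; rewrite -x0E => fE'.
exact (edge_radon_sphere_sum hT fE' g0 n).
Qed.

Lemma sum_edge_radon_radial w (l : int -> C) :
  \sum_(n \in [set: int]) l n * edge_radon e0 f w n
  = \sum_(m < N) g m * sphere_sum q m l.
Proof.
have [b [p hb]] := horofunction_exists hT w.
have [x0 x0E] := parent_edge_surj hb e0; move: fE; rewrite -x0E => fE'.
exact (sum_edge_radon hT fE' g0 l).
Qed.

End Profile.

(** The assumption [0 < q] comes for free: an end forces it, and without ends inversion is
    vacuous. *)
Lemma inversion_coef_sphere_sum (C : comPzRingType) (l : int -> C) :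
    ((0 < q)%N -> forall m, sphere_sum q m l = (m == 0)%:R) ->
  inversion_coef e0 l.
Proof.
move=> + f fin rad w => /(_ (tree_end_degree_gt0 w)) lE.
have [g [N [fE g0]]] := radial_profile w fin rad.
rewrite (sum_edge_radon_radial fE g0); have -> : f e0 = g 0%N.
  by rewrite fE; congr g; apply: gdist_eq; [exists [::]|].
case: N g0 => [g0|N _]; first by rewrite big_ord0 g0.
rewrite big_ord_recl lE eqxx mulr1 big1 ?addr0 // => i _.
by rewrite lE mulr0.
Qed.

End RadialRadon.

(** * Solving the linear system for the coefficients *)

Section Coefficients.
Variables (F : numFieldType) (q : nat).
Hypothesis q_gt0 : (0 < q)%N.
Local Notation Q := (q%:R : F).

(** The part of [sphere_sum] from indices with both coordinates positive, without its factor
    [q - 1]. *)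
Definition branch_sum (l : int -> F) (m : nat) : F :=
  \sum_(i < m) Q ^+ i * l (m%:Z - 1 - (2 * i)%:Z).

Lemma sphere_sumS l m : sphere_sum q m.+1 l =
  l m.+1%:Z + Q ^+ m.+1 * l (- m.+1%:Z) + (Q - 1) * branch_sum l m.+1.
Proof.
rewrite /sphere_sum /sphere_indices 2!big_cons big_map -[iota 0 m.+1]/(index_iota 0 m.+1).
rewrite big_mkord /= addrCA addrA; congr (_ + _ + _).
- by rewrite mul1r subr0.
- by rewrite natrX sub0r.
rewrite mulr_sumr; apply: eq_bigr => i _ /=.
have -> : (m.+1 - i)%N = (m - i).+1 by have := ltn_ord i; lia.
rewrite /index_weight natrM natrX -subn1 natrB // mulrA; congr (_ * l _).
by have := ltn_ord i; lia.
Qed.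

Lemma branch_sumSS l m : branch_sum l m.+2 =
  l m.+1%:Z + Q ^+ m.+1 * l (- m.+1%:Z) + Q * branch_sum l m.
Proof.
rewrite /branch_sum big_ord_recl big_ord_recr /= mulr_sumr addrCA addrC.
congr (_ + _ + _).
- by rewrite expr0 mul1r; congr l; lia.
- by congr (_ * l _); rewrite /bump /=; lia.
- apply: eq_bigr => i _; rewrite exprS mulrA; congr (_ * l _).
  by rewrite /bump /=; lia.
Qed.

Lemma one_plus_degree_neq0 : 1 + Q != 0.
Proof. by rewrite addrC natr1 pnatr_eq0. Qed.

(* By [branch_sumSS], [a_m = (1 - q) * branch_sum l m] satisfies
   [a_(m+2) + (q - 1) a_(m+1) - q a_m = 0], whose characteristic roots are [1]
   and [-q]. *)
Lemma sphere_sum_eq (l : int -> F) : l 0 = 1 ->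
  (forall m, l m.+1%:Z + Q ^+ m.+1 * l (- m.+1%:Z)
     = (1 - Q) / (1 + Q) * (1 - (- Q) ^+ m.+1)) ->
  forall m, sphere_sum q m l = (m == 0)%:R.
Proof.
move=> l0 lS; have Q0 := one_plus_degree_neq0.
have bS m : (Q - 1) * branch_sum l m.+1
    = - ((1 - Q) / (1 + Q) * (1 - (- Q) ^+ m.+1)).
  (* The induction carries two consecutive values because [branch_sumSS] relates values two
     apart. *)
  suff [] : (Q - 1) * branch_sum l m.+1
      = - ((1 - Q) / (1 + Q) * (1 - (- Q) ^+ m.+1)) /\
    (Q - 1) * branch_sum l m.+2
      = - ((1 - Q) / (1 + Q) * (1 - (- Q) ^+ m.+2)) by [].
  elim: m => [|m [IH1 IH2]].
    split; last first.
      by rewrite branch_sumSS lS /branch_sum big_ord0; field.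
    by rewrite /branch_sum big_ord_recl big_ord0 /= l0; field.
  split=> //; rewrite branch_sumSS lS mulrDr [X in _ + X]mulrCA IH1 !exprS; field.
  exact: Q0.
case=> [|m]; last by rewrite sphere_sumS lS bS subrr.
by rewrite /sphere_sum big_seq1 /= mul1r l0.
Qed.

Lemma sphere_sum_edge_coef1 m : sphere_sum q m (edge_coef1 F q) = (m == 0)%:R.
Proof.
apply: sphere_sum_eq => // k; rewrite /edge_coef1 /= mulr0 addr0 //.
Qed.

Lemma sphere_sum_edge_coef2 m : sphere_sum q m (edge_coef2 F q) = (m == 0)%:R.
Proof.
apply: sphere_sum_eq => // k; rewrite /edge_coef2 /=.
have -> : (-1 : F) ^ (- k.+1%:Z) = (-1) ^+ k.+1.
  by rewrite -exprz_inv invrN1.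
rewrite -exprnP [(- Q) ^+ _]exprNn; have := one_plus_degree_neq0.
set s := (-1) ^+ k.+1; set t := Q ^+ k.+1 => Q0; field; exact: Q0.
Qed.

(** The free values at negative indices are the bits of [A]; those at positive indices are then
    forced by the hypothesis of [sphere_sum_eq]. *)
Definition coef_of_bits (A : nat -> bool) (n : int) : F :=
  match n with
  | Posz 0 => 1
  | Posz m.+1 => (1 - Q) / (1 + Q) * (1 - (- Q) ^+ m.+1) - Q ^+ m.+1 * (A m)%:R
  | Negz m => (A m)%:R
  end.

Lemma sphere_sum_coef_of_bits A m : sphere_sum q m (coef_of_bits A) = (m == 0)%:R.
Proof. by apply: sphere_sum_eq => // k; rewrite /= subrK. Qed.

End Coefficients.

(** * Uncountability and the final statement *)

Lemma coef_of_bits_inj (F : numFieldType) q : injective (@coef_of_bits F q).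
Proof.
move=> A B AB; apply/funext => m; have := congr1 (@^~ (Negz m)) AB.
by rewrite /=; case: (A m) (B m) => -[] // /eqP; rewrite ?oner_eq0 // eq_sym oner_eq0.
Qed.

Lemma uncountable_range_bits (T : Type) (c : (nat -> bool) -> T) (S : set T) :
  injective c -> (forall A, S (c A)) -> ~ countable S.
Proof.
move=> cI cS /countable_injP[h hI].
(* Cantor's diagonal: [D] contradicts itself at its own code [h (c D)]. *)
pose D n := ~~ `[< exists A, h (c A) = n /\ A n >].
have Dh : D (h (c D)) = ~~ D (h (c D)).
  rewrite {1}/D; congr negb; apply/asboolP/idP => [[A [hA AD]]|Dn]; last by exists D.
  have /cI AD_ : c A = c D by apply: hI; rewrite ?inE.
  by rewrite AD_ in AD.
by case: D Dh.
Qed.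

Lemma edge_coef_neq (F : numFieldType) (q : nat) : edge_coef1 F q <> edge_coef2 F q.
Proof.
(* At [-1] the first family vanishes and the second is a power of [-1]. *)
move=> /(congr1 (@^~ (-1))); rewrite /edge_coef1 /edge_coef2 /= => /eqP.
by apply/negP; rewrite eq_sym expfz_neq0 // oppr_eq0 oner_eq0.
Qed.

Theorem theorem3p2p5 (R : realType) (q : nat) (V : choiceType) (adj : rel V)
    (hT : homogeneous_tree q adj) (e0 : edge adj) :
  [/\ forall f : edge adj -> R[i], finitely_supported f -> radial e0 f ->
        forall (w w' : tree_end adj) (n : int),
          edge_radon e0 f w n = edge_radon e0 f w' n,
      ~ countable [set l : int -> R[i] | inversion_coef e0 l],
      inversion_coef e0 (edge_coef1 R[i] q),
      inversion_coef e0 (edge_coef2 R[i] q)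
    & edge_coef1 R[i] q <> edge_coef2 R[i] q].
Proof.
split.
- move=> f fin rad w w' n.
  have [g [N [fE g0]]] := radial_profile hT w fin rad.
  by rewrite !(edge_radon_radial hT fE g0).
- apply: (uncountable_range_bits (@coef_of_bits_inj R[i] q)) => A.
  apply: (inversion_coef_sphere_sum hT) => q0; exact: sphere_sum_coef_of_bits.
- by apply: (inversion_coef_sphere_sum hT) => q0; exact: sphere_sum_edge_coef1.
- by apply: (inversion_coef_sphere_sum hT) => q0; exact: sphere_sum_edge_coef2.
- exact: edge_coef_neq.
Qed.
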